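(* Let $A\in\mathbb{H}^{m\times n}$ have rank $\nu$, and suppose $A=G_2F_2$ is an arbitrary full rank decomposition of $A$. Then $\mathcal{R}_l(A)=\mathcal{R}_l(F_2)$ and $\mathcal{N}_l(A)=\mathcal{N}_l(G_2)$.
   Context: $\mathbb{H}$ denotes the real quaternions. For $B\in\mathbb{H}^{m\times n}$, $\mathcal{R}_l(B)=\{xB : x\in\mathbb{H}^{1\times m}\}$ and $\mathcal{N}_l(B)=\{x\in\mathbb{H}^{1\times m} : xB=0\}$. The rank of $B$ is the maximal number of right linearly independent columns (equivalently, of left linearly independent rows). A full rank decomposition $A=G_2F_2$ of a rank-$\nu$ matrix $A\in\mathbb{H}^{m\times n}$ has $G_2\in\mathbb{H}^{m\times\nu}$, $F_2\in\mathbb{H}^{\nu\times n}$ and $\operatorname{rank}(G_2)=\operatorname{rank}(F_2)=\nu$. *)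

(* Defs.v *)
From HB Require Import structures.
From mathcomp Require Import all_boot all_order all_algebra.
From mathcomp Require Import ring.
From mathcomp Require Import boolp classical_sets reals.

Set Implicit Arguments.
Unset Strict Implicit.
Unset Printing Implicit Defensive.

Import GRing.Theory.
Local Open Scope classical_set_scope.
Local Open Scope ring_scope.

(* Quat a b c d is the quaternion a + b i + c j + d k. *)
Record quaternion (R : realType) : Type :=
  Quat { qre : R; qimi : R; qimj : R; qimk : R }.

Section QuaternionRing.
Variable R : realType.
Local Notation H := (quaternion R).
Implicit Types x y z : H.

Definition quat_to_prod x : R * R * R * R := (qre x, qimi x, qimj x, qimk x).
Definition quat_of_prod (p : R * R * R * R) : H :=
  let: (a, b, c, d) := p in Quat a b c d.

Lemma quat_to_prodK : cancel quat_to_prod quat_of_prod.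
Proof. by case. Qed.

HB.instance Definition _ := Choice.copy H (can_type quat_to_prodK).

Definition addq x y : H :=
  Quat (qre x + qre y) (qimi x + qimi y) (qimj x + qimj y) (qimk x + qimk y).
Definition oppq x : H := Quat (- qre x) (- qimi x) (- qimj x) (- qimk x).
Definition zeroq : H := Quat 0 0 0 0.
Definition oneq : H := Quat 1 0 0 0.

Definition mulq x y : H :=
  let: Quat a1 b1 c1 d1 := x in
  let: Quat a2 b2 c2 d2 := y in
  Quat (a1 * a2 - b1 * b2 - c1 * c2 - d1 * d2)
       (a1 * b2 + b1 * a2 + c1 * d2 - d1 * c2)
       (a1 * c2 - b1 * d2 + c1 * a2 + d1 * b2)
       (a1 * d2 + b1 * c2 - c1 * b2 + d1 * a2).

Lemma addqA : associative addq.
Proof. by move=> [????] [????] [????]; rewrite /addq /= !addrA. Qed.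

Lemma addqC : commutative addq.
Proof. by move=> [a b c d] [????]; rewrite /addq /= ![_ + a]addrC; congr Quat; ring. Qed.

Lemma add0q : left_id zeroq addq.
Proof. by move=> [????]; rewrite /addq /= !add0r. Qed.

Lemma addNq : left_inverse zeroq oppq addq.
Proof. by move=> [????]; rewrite /addq /= !addNr. Qed.

HB.instance Definition _ := GRing.isZmodule.Build H addqA addqC add0q addNq.

Lemma mulqA : associative mulq.
Proof. by move=> [????] [????] [????]; congr Quat; ring. Qed.

Lemma mul1q : left_id oneq mulq.
Proof. by move=> [????]; congr Quat; ring. Qed.

Lemma mulq1 : right_id oneq mulq.
Proof. by move=> [????]; congr Quat; ring. Qed.

Lemma mulqDl : left_distributive mulq addq.
Proof. by move=> [????] [????] [????]; congr Quat => /=; ring. Qed.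

Lemma mulqDr : right_distributive mulq addq.
Proof. by move=> [????] [????] [????]; congr Quat => /=; ring. Qed.

Lemma oneq_neq0 : oneq != zeroq.
Proof. by apply/eqP => -[] /eqP; rewrite oner_eq0. Qed.

HB.instance Definition _ :=
  GRing.Zmodule_isNzRing.Build H mulqA mul1q mulq1 mulqDl mulqDr oneq_neq0.

Lemma quaternion_units (i := Quat 0 1 0 0 : H) (j := Quat 0 0 1 0 : H)
    (k := Quat 0 0 0 1 : H) :
  [/\ i * i = -1, j * j = -1, k * k = -1 & i * j * k = -1].
Proof. by split; congr Quat => /=; ring. Qed.

End QuaternionRing.

Section QuaternionMatrix.
Variable R : realType.
Local Notation H := (quaternion R).

Definition left_range m n (B : 'M[H]_(m, n)) : set 'rV[H]_n :=
  [set x *m B | x in [set: 'rV[H]_m]].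

Definition left_null m n (B : 'M[H]_(m, n)) : set 'rV[H]_m :=
  [set x | x *m B = 0].

Definition right_independent_columns m n (B : 'M[H]_(m, n)) (S : {set 'I_n}) :
    Prop :=
  forall c : 'I_n -> H,
    (forall i, \sum_(j in S) B i j * c j = 0) -> forall j, j \in S -> c j = 0.

(* MathComp's mxrank needs a commutative field of coefficients. *)
Definition qrank m n (B : 'M[H]_(m, n)) : nat :=
  \max_(S : {set 'I_n} | `[< right_independent_columns B S >]) #|S|.

Definition full_rank_decomposition m n nu (A : 'M[H]_(m, n))
    (G : 'M[H]_(m, nu)) (F : 'M[H]_(nu, n)) : Prop :=
  [/\ A = G *m F, qrank G = nu & qrank F = nu].

End QuaternionMatrix.

(* Main.v *)
(** Over a division ring, elimination on a pivot of the first column shows that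
    a matrix with right independent columns has a left inverse and at least as
    many rows as columns.  Hence [G2] has a left inverse [X], so that
    [y F2 = (y X) A].  Moreover, among the [nu] independent columns of [F2], no
    row can depend on the other [nu - 1] rows, so [F2] can be cancelled on the
    right in [x G2 F2 = 0]. *)

Require Import Defs.
From mathcomp Require Import all_boot all_order all_algebra.
From mathcomp Require Import boolp classical_sets reals.
From mathcomp Require Import ring.

Set Implicit Arguments.
Unset Strict Implicit.
Unset Printing Implicit Defensive.

Import Order.TTheory GRing.Theory Num.Theory.
Local Open Scope ring_scope.

Definition division_ring (D : nzRingType) : Prop :=
  forall x : D, x != 0 -> exists y, y * x = 1.

Definition right_injective (D : nzRingType) m n (B : 'M[D]_(m, n)) : Prop :=
  forall c : 'cV_n, B *m c = 0 -> c = 0.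

(** A left inverse [y] of [x] is nonzero, so it has a left inverse [z] of its own, and
    [z = z * (y * x) = x]. *)
Lemma division_ring_inv (D : nzRingType) (x : D) :
  division_ring D -> x != 0 -> exists y, y * x = 1 /\ x * y = 1.
Proof.
move=> divD /divD[y yx1]; exists y; split=> //.
have /divD[z zy1] : y != 0.
  by apply/eqP => y0; move/eqP: yx1; rewrite y0 mul0r eq_sym oner_eq0.
by rewrite -[x]mul1r -zy1 -(mulrA z y) yx1 mulr1.
Qed.

Lemma division_ring_mul0 (D : nzRingType) (x y : D) :
  division_ring D -> x != 0 -> x * y = 0 -> y = 0.
Proof. by move=> divD /divD[z zx1] xy0; rewrite -[y]mul1r -zx1 -mulrA xy0 mulr0. Qed.

(** [1%:M - b *m p] is the elimination step: it annihilates [b] because [p *m b = 1%:M], and its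
    zero row is the pivot row. *)
Lemma cV_pivot (D : nzRingType) m (b : 'cV[D]_m) :
    division_ring D -> b != 0 ->
  exists (i : 'I_m) (p : 'rV_m), p *m b = 1%:M /\ row i (1%:M - b *m p) = 0.
Proof.
move=> divD b0.
have [i bi0] : exists i, b i 0 != 0.
  apply/existsP; rewrite -[[exists _, _]]negbK negb_exists.
  apply: contra b0 => /forallP b0; apply/eqP/colP => i.
  by have := b0 i; rewrite negbK mxE => /eqP.
have [y [yb by1]] := division_ring_inv divD bi0.
(* [p *m b = 1%:M] uses [y] as a left inverse of the pivot, the vanishing row uses it as a right
   inverse. *)
exists i, (y *: delta_mx 0 i); split.
  by apply/matrixP => k l; rewrite !ord1 -scalemxAl -rowE !mxE yb.
apply/rowP => j; rewrite !mxE big_ord1 !mxE eqxx eq_sym andTb mulrA by1 mul1r.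
by rewrite subrr.
Qed.

(** A kernel vector [c] of the eliminated matrix extends to the kernel vector [(- p B c, c)] of
    [row_mx b B]. *)
Lemma right_injective_elim (D : nzRingType) m n (b : 'cV[D]_m)
    (B : 'M[D]_(m, n)) (p : 'rV_m) :
  right_injective (row_mx b B) -> right_injective ((1%:M - b *m p) *m B).
Proof.
move=> injB c; rewrite -mulmxA mulmxBl mul1mx => Bc.
have /injB : row_mx b B *m col_mx (- (p *m (B *m c))) c = 0.
  by rewrite mul_row_col mulmxN addrC (mulmxA b).
by rewrite -col_mx0 => /eq_col_mx[].
Qed.

Lemma right_injective_col (D : nzRingType) m n (b : 'cV[D]_m)
    (B : 'M[D]_(m, n)) :
  right_injective (row_mx b B) -> b != 0.
Proof.
move=> injB; apply/eqP => b0.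
have /injB : row_mx b B *m col_mx (1%:M : 'M_1) 0 = 0.
  by rewrite mul_row_col b0 mul0mx mulmx0 addr0.
rewrite -col_mx0 => /eq_col_mx[] /matrixP /(_ 0 0) /eqP.
by rewrite !mxE oner_eq0.
Qed.

Lemma right_injective_left_inverse (D : nzRingType) m n (B : 'M[D]_(m, n)) :
  division_ring D -> right_injective B -> exists X, X *m B = 1%:M.
Proof.
move=> divD; elim: n B => [|n IHn] B.
  by exists 0; apply/matrixP; case.
rewrite -[n.+1]/(1 + n)%N in B *; rewrite -[B]hsubmxK.
move: (lsubmx B) (rsubmx B) => b C injB.
have [_ [p [pb1 _]]] := cV_pivot divD (right_injective_col injB).
have [X] := IHn _ (right_injective_elim (p := p) injB).
rewrite mulmxA; set Y := X *m _ => YC.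
have Yb : Y *m b = 0.
  by rewrite /Y -mulmxA mulmxBl mul1mx -mulmxA pb1 mulmx1 subrr mulmx0.
clearbody Y.
(* Since [Y] kills [b], subtracting [p C Y] from [p] makes the top row kill [C] and keeps its
   product with [b] equal to 1. *)
exists (col_mx (p - p *m C *m Y) Y).
rewrite mul_col_row !mulmxBl -!mulmxA Yb YC pb1 !mulmx0 mulmx1 subr0 subrr.
by rewrite -scalar_mx_block.
Qed.

(** Dependence of row [i] on the other rows is phrased through kernels, which covers both a zero row
    and a row with nonzero coefficient in a left relation. *)
Lemma right_injective_row' (D : nzRingType) m n (E : 'M[D]_(m.+1, n))
    (i : 'I_m.+1) :
  right_injective E ->
  (forall c : 'cV_n, row' i E *m c = 0 -> (E *m c) i 0 = 0) ->
  right_injective (row' i E).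
Proof.
move=> injE depi c Ec; apply: injE; apply/colP => k; rewrite [RHS]mxE.
have [<-|/unlift_some[l -> _]] := eqVneq i k; first exact: depi.
move/colP/(_ l): Ec; rewrite !mxE => Ec; rewrite -[RHS]Ec.
by apply: eq_bigr => j _; rewrite mxE.
Qed.

Lemma right_injective_leq (D : nzRingType) m n (B : 'M[D]_(m, n)) :
  division_ring D -> right_injective B -> (n <= m)%N.
Proof.
move=> divD; elim: n m B => // n IHn m B.
rewrite -[n.+1]/(1 + n)%N in B *; rewrite -[B]hsubmxK.
move: (lsubmx B) (rsubmx B) => b C injB.
have [i [p [_ pi0]]] := cV_pivot divD (right_injective_col injB).
move: pi0 (right_injective_elim (p := p) injB).
case: m => [|m] in B b C injB i p *; first by case: i.
move=> pi0 injE; rewrite add1n ltnS; apply: IHn (right_injective_row' (i := i) injE _).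
move=> c _; rewrite -mulmxA; set v := C *m c.
have -> : ((1%:M - b *m p) *m v) i 0 = (row i (1%:M - b *m p) *m v) 0 0.
  by rewrite -row_mul [RHS]mxE.
by rewrite pi0 mul0mx mxE.
Qed.

(** If entry [i] of [y] were nonzero, row [i] would depend on the others, and deleting it would
    leave an injective matrix with more columns than rows. *)
Lemma right_injective_square (D : nzRingType) n (B : 'M[D]_n) (y : 'rV_n) :
  division_ring D -> right_injective B -> y *m B = 0 -> y = 0.
Proof.
move=> divD injB yB0; apply/rowP => i; rewrite [RHS]mxE.
apply/eqP/negP => /negP yi0.
move: yi0; case: n => [|n] in B y injB yB0 i *; first by case: i.
move=> yi0.
have /(right_injective_leq divD) : right_injective (row' i B).
  apply: right_injective_row' injB _ => c Bc.
  apply: (division_ring_mul0 divD yi0).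
  (* As the other rows kill [c], only the term of index [i] survives in this product. *)
  have : (y *m (B *m c)) 0 0 = 0 by rewrite mulmxA yB0 mul0mx mxE.
  rewrite mxE (bigD1 i) //= big1 ?addr0 // => k.
  rewrite eq_sym => /unlift_some[l -> _].
  suff -> : (B *m c) (lift i l) 0 = (row' i B *m c) l 0.
    by rewrite Bc mxE mulr0.
  by rewrite !mxE; apply: eq_bigr => j _; rewrite mxE.
by rewrite ltnn.
Qed.

Lemma quaternion_division_ring (R : realType) : division_ring (quaternion R).
Proof.
case=> a b c d x0; pose N := a ^+ 2 + b ^+ 2 + c ^+ 2 + d ^+ 2.
have N0 : N != 0.
  apply: contra x0; rewrite /N !paddr_eq0 ?addr_ge0 ?sqr_ge0 // !sqrf_eq0.
  by move=> /andP[/andP[/andP[/eqP-> /eqP->] /eqP->] /eqP->].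
(* The inverse is the conjugate divided by the squared norm. *)
exists (Quat (a / N) (- b / N) (- c / N) (- d / N)).
by congr Quat; rewrite /N in N0 *; field.
Qed.

(** The empty set of columns is independent, so the maximum runs over a nonempty family and is
    attained. *)
Lemma qrank_witness (R : realType) m n (B : 'M[quaternion R]_(m, n)) :
  exists2 S : {set 'I_n}, right_independent_columns B S & #|S| = qrank B.
Proof.
have P0 : (0 < #|[pred S : {set 'I_n} | `[< right_independent_columns B S >]]|)%N.
  apply/card_gt0P; exists finset.set0; apply: asboolT => c _ j.
  by rewrite finset.in_set0.
have [S PS eS] := eq_bigmax_cond (fun S : {set 'I_n} => #|S|) P0.
by exists S; [apply/asboolP | rewrite -eS].
Qed.

Lemma right_injective_colsub (R : realType) m n (B : 'M[quaternion R]_(m, n))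
    (S : {set 'I_n}) :
  right_independent_columns B S ->
  right_injective (colsub (enum_val : 'I_#|S| -> 'I_n) B).
Proof.
(* [d] extends [c] by zero outside [S]: its sum has one term if [j] is in [S] and none otherwise. *)
move=> indS c Bc0; pose d j := \sum_(k : 'I_#|S| | enum_val k == j) c k 0.
have dE k : d (enum_val k) = c k 0.
  by rewrite /d (eq_bigl (pred1 k)) ?big_pred1_eq // => l; rewrite (inj_eq enum_val_inj).
apply/colP => k; rewrite -dE mxE; apply: indS (enum_valP k) => i.
rewrite big_enum_val /=; move/colP/(_ i): Bc0; rewrite !mxE => Bc0.
by rewrite -[RHS]Bc0; apply: eq_bigr => l _; rewrite dE mxE.
Qed.

Lemma qrank_full_right_injective (R : realType) m n
    (B : 'M[quaternion R]_(m, n)) :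
  qrank B = n -> right_injective B.
Proof.
move=> rkB c Bc0; have [S indS] := qrank_witness B; rewrite rkB => cardS.
have ST j : j \in S.
  suff -> : S = finset.setTfor 'I_n by rewrite finset.in_setT.
  by apply/eqP; rewrite eqEcard finset.subsetT cardsT card_ord cardS leqnn.
apply/colP => j; rewrite mxE; apply: (indS (c^~ 0)) (ST j) => i.
move/colP/(_ i): Bc0; rewrite !mxE => Bc0; rewrite -[RHS]Bc0.
by apply: eq_big => // k; rewrite ST.
Qed.

Lemma qrank_full_left_cancel (R : realType) m n (B : 'M[quaternion R]_(m, n))
    (y : 'rV_m) :
  qrank B = m -> y *m B = 0 -> y = 0.
Proof.
have [S indS <-] := qrank_witness B => cardS yB0.
(* Substituting [#|S|] for [m] gives the submatrix of independent columns a square type. *)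
case: _ / cardS in B indS y yB0 *.
apply: right_injective_square (right_injective_colsub indS) _.
  exact: quaternion_division_ring.
by rewrite mulmx_colsub yB0; apply/matrixP => i j; rewrite !mxE.
Qed.

Theorem theorem4p10 (R : realType) (m n nu : nat)
    (A : 'M[quaternion R]_(m, n))
    (G2 : 'M[quaternion R]_(m, nu)) (F2 : 'M[quaternion R]_(nu, n))
    (rankA : qrank A = nu)
    (decA : full_rank_decomposition A G2 F2) :
  left_range A = left_range F2 /\ left_null A = left_null G2.
Proof.
have [-> rkG rkF] := decA; split; apply/seteqP; split => x.
- by move=> [y _ <-]; exists (y *m G2); rewrite ?mulmxA.
- have [X XG] := right_injective_left_inverse (@quaternion_division_ring R)
    (qrank_full_right_injective rkG).
  move=> [y _ <-]; exists (y *m X) => //.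
  by rewrite mulmxA -(mulmxA y) XG mulmx1.
- by rewrite /left_null /= mulmxA; apply: qrank_full_left_cancel.
- by rewrite /left_null /= mulmxA => ->; rewrite mul0mx.
Qed.
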